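(* Let $(\Delta_n)_{n\in\mathbb{N}}$ be any $\operatorname{Sym}$-invariant chain of simplicial complexes, where $\Delta_n$ has vertex set $V_n=[n]^c$. Then the number of $\operatorname{Sym}(n)$-orbits of facets of the Alexander dual $\Delta_n^\vee$ grows polynomially in $n$ eventually; that is, there is a polynomial $p$ in one variable such that, for all sufficiently large $n$, the number of $\operatorname{Sym}(n)$-orbits of facets of $\Delta_n^{\vee}$ equals $p(n)$.
   Context: $\mathbb{N}$ denotes the positive integers and $[n]=\{1,\dots,n\}$. Fix $c\in\mathbb{N}$. Let $V_n=[n]^c:=\{j_i \mid i\in[c],\ j\in[n]\}$ (that is, $c$ disjoint copies of $[n]$), so $V_m\subseteq V_n$ for $m\le n$. The symmetric group $\operatorname{Sym}(n)$ acts on $V_n$ by $\sigma\cdot j_i=(\sigma(j))_i$. A sequence $(\Delta_n)_{n\in\mathbb{N}}$ of simplicial complexes, $\Delta_n$ on vertex set $V_n$, is a $\operatorname{Sym}$-invariant chain if (1) for all $m\le n$, every $\sigma\in\operatorname{Sym}(n)$ maps every face of $\Delta_m$ onto a face of $\Delta_n$, and (2) for every $n$ the $c$-fold cone over $\Delta_n$ with apices $V_{n+1}-V_n$, i.e. $\{F\cup G \mid F\in\Delta_n,\ G\subseteq V_{n+1}-V_n\}$, is contained in $\Delta_{n+1}$. The Alexander dual of a simplicial complex $\Delta$ on vertex set $V$ is $\Delta^\vee=\{V-F \mid F\subseteq V,\ F\notin\Delta\}$, again on vertex set $V$; the dual $\Delta_n^\vee$ is taken with respect to $V_n$ and is $\operatorname{Sym}(n)$-invariant.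 *)

(* Defs.v *)
From mathcomp Require Import all_boot all_order all_algebra all_fingroup.

Set Implicit Arguments.
Unset Strict Implicit.
Unset Printing Implicit Defensive.

(* A complex on the vertex set T is a set of faces.  Not every point of T has  *)
(* to be a face, and the void complex set0 is allowed, as the Alexander dual   *)
(* of the full simplex is void.                                                *)
Definition simplicial_complex (T : finType) (D : {set {set T}}) : Prop :=
  forall F G : {set T}, F \in D -> G \subset F -> G \in D.

Definition facets (T : finType) (D : {set {set T}}) : {set {set T}} :=
  [set F | maxset (mem D) F].

Definition alexander_dual (T : finType) (D : {set {set T}}) : {set {set T}} :=
  [set ~: F | F in ~: D].

(* The pair (i, j) is the element j of the i-th copy of [n]; indices are       *)
(* shifted to start from 0.                                                    *)
Definition vert (c n : nat) : finType := ('I_c * 'I_n)%type.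

Definition widen_vert (c m n : nat) (le_mn : m <= n) (v : vert c m) :
  vert c n := (v.1, widen_ord le_mn v.2).

Definition sym_vert (c n : nat) (v : vert c n) (s : 'S_n) : vert c n :=
  (v.1, s v.2).

Lemma sym_vert_is_action (c n : nat) :
  is_action [set: 'S_n] (@sym_vert c n).
Proof.
split=> [s [i j] [i' j'] [-> /perm_inj ->] // | [i j] s t _ _].
by rewrite /sym_vert /= permM.
Qed.

Canonical sym_action (c n : nat) : {action 'S_n &-> vert c n} :=
  Action (sym_vert_is_action c n).

Definition new_verts (c n : nat) : {set vert c n.+1} :=
  ~: (widen_vert (leqnSn n) @: [set: vert c n]).

Definition cone (c n : nat) (D : {set {set vert c n}}) :
  {set {set vert c n.+1}} :=
  [set (widen_vert (leqnSn n) @: F) :|: G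
     | F : {set vert c n} in D, G : {set vert c n.+1} in powerset (new_verts c n)].

(* Chains are indexed by the positive integers: nothing is required of D 0.    *)
Definition sym_invariant_chain (c : nat)
    (D : forall n : nat, {set {set vert c n}}) : Prop :=
  [/\ forall n, 0 < n -> simplicial_complex (D n),
      forall (m n : nat) (le_mn : m <= n) (s : 'S_n) (F : {set vert c m}),
        0 < m -> F \in D m ->
        ((sym_action c n)^*)%act (widen_vert le_mn @: F) s \in D n
    & forall n, 0 < n -> cone (D n) \subset D n.+1].

Definition num_facet_orbits (c n : nat) (D : {set {set vert c n}}) : nat :=
  #|orbit ((sym_action c n)^*)%act [set: 'S_n] @: facets D|.

(* Main.v *)
(* Up to Sym(n), a subset of [n]^c is the multiset of its n columns, that is a *)
(* vector of N^(2^c) with sum n.  The cone condition says that the vectors of  *)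
(* faces form an upward closed set.  The facets of the dual are the            *)
(* complements of the minimal nonfaces; minimality only involves replacing a   *)
(* column S by S minus a point, so the vectors of the minimal nonfaces form a  *)
(* Boolean combination of upward closed sets.  By Dickson's lemma the slices   *)
(* x_1 = i of an upward closed set do not depend on i for large i, and this    *)
(* (recursive) stability passes to Boolean combinations; so the number of      *)
(* vectors with sum n is, recursively, a partial sum of a function which is    *)
(* eventually polynomial, plus finitely many shifts of such functions.         *)

Require Import Defs.
From mathcomp Require Import all_boot all_order all_algebra all_fingroup.
From Stdlib Require Import Classical_Prop.

Set Implicit Arguments.
Unset Strict Implicit.
Unset Printing Implicit Defensive.

Import GRing.Theory Num.Theory.

(** Facets of the dual are complements of minimal nonfaces ([facets_dualP]), and two subsets of
    [n]^c share an orbit exactly when their columns agree as multisets ([orbit_eq_columns]). So the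
    orbits correspond to the vectors of sum n, indexed by the 2^c column types, whose words are
    minimal nonfaces ([num_facet_orbits_dual]).

    Minimal nonfaces are not upward closed, but the conditions defining them are built from
    predicates that are: being a face ([upward_is_face]), containing a column S, and containing S
    with a face resulting when S is replaced by S minus a point ([upward_replace]). Dickson's lemma
    makes upward closed sets [tame] ([upset_tame]), and [tame] sets form a Boolean algebra. For a
    [tame] set, the number of vectors of sum n is eventually polynomial ([tame_count]): all slices
    from some point on are equal, so their contributions form a partial sum. *)

Section EventuallyPolynomial.

(** * Eventually polynomial functions and their partial sums *)

Local Open Scope ring_scope.

Definition eventually_poly (h : nat -> nat) : Prop :=
  exists p : {poly rat}, exists N : nat, forall n : nat, (N <= n)%N ->
    (h n)%:R = p.[n%:R] :> rat.

Lemma eventually_poly_eq_from (N : nat) (h g : nat -> nat) :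
  (forall n, (N <= n)%N -> h n = g n) -> eventually_poly h -> eventually_poly g.
Proof.
move=> eq_hg [p [M hp]]; exists p, (maxn N M) => n.
by rewrite geq_max => /andP[leNn leMn]; rewrite -eq_hg ?hp.
Qed.

Lemma eventually_poly_add (h g : nat -> nat) :
  eventually_poly h -> eventually_poly g ->
  eventually_poly (fun n => (h n + g n)%N).
Proof.
move=> [p [M hp]] [q [N gq]]; exists (p + q), (maxn M N) => n.
by rewrite geq_max => /andP[leMn leNn]; rewrite natrD hp // gq // hornerD.
Qed.

Lemma eventually_poly_sum (m : nat) (h : nat -> nat -> nat) :
  (forall i, eventually_poly (h i)) ->
  eventually_poly (fun n => (\sum_(i < m) h i n)%N).
Proof.
move=> hP; elim: m => [|m IHm].
  by exists 0, 0%N => n _; rewrite big_ord0 horner0.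
apply: (@eventually_poly_eq_from 0) (eventually_poly_add IHm (hP m)) => n _.
by rewrite big_ord_recr.
Qed.

Lemma eventually_poly_shift (i : nat) (h : nat -> nat) :
  eventually_poly h -> eventually_poly (fun n => h (n - i)%N).
Proof.
(* Subtraction truncates below [i]; from [N + i] on, [n - i] is a true difference and is at least
   [N]. *)
move=> [p [N hp]]; exists (p \Po ('X - i%:R%:P)), (N + i)%N => n leNin.
have le_in : (i <= n)%N by apply: leq_trans leNin; rewrite leq_addl.
by rewrite hp ?leq_subRL 1?addnC // horner_comp !hornerE -natrB.
Qed.

(** [q] is a discrete antiderivative of [p], so sums of values of [p] telescope. *)
Definition is_difference (p : {poly rat}) : Prop :=
  exists q : {poly rat}, forall x, q.[x + 1] - q.[x] = p.[x].

Lemma is_difference0 : is_difference 0.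
Proof. by exists 0 => x; rewrite !horner0 subr0. Qed.

Lemma is_differenceD (p q : {poly rat}) :
  is_difference p -> is_difference q -> is_difference (p + q).
Proof.
move=> [P hP] [Q hQ]; exists (P + Q) => x.
by rewrite !hornerD -hP -hQ opprD addrACA.
Qed.

Lemma is_differenceZ (a : rat) (p : {poly rat}) :
  is_difference p -> is_difference (a *: p).
Proof.
by move=> [P hP]; exists (a *: P) => x; rewrite !hornerZ -hP mulrBr.
Qed.

(* (x + 1)^(d+1) - x^(d+1) has leading term (d+1) x^d. *)
Lemma is_differenceXn (d : nat) : is_difference 'X^d.
Proof.
elim/ltn_ind: d => d IHd.
(* The full sum is the difference of X^(d+1) by the binomial theorem; the subtracted one has degree
   below d and falls to induction. *)
have -> : 'X^d = d.+1%:R^-1 *: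
    (\sum_(i < d.+1) 'X^i *+ 'C(d.+1, i)
     + (- 1) *: \sum_(i < d) 'X^i *+ 'C(d.+1, i)) :> {poly rat}.
  rewrite big_ord_recr /= scaleN1r addrAC subrr add0r -scaler_nat.
  by rewrite scalerA binSn mulVf ?scale1r // pnatr_eq0.
apply: is_differenceZ; apply: is_differenceD; last first.
  apply: is_differenceZ; apply: big_ind => [||i _].
  - exact: is_difference0.
  - exact: is_differenceD.
  by rewrite -scaler_nat; apply/is_differenceZ/IHd.
exists 'X^(d.+1) => x; rewrite !hornerXn [x + 1]addrC exprDn big_ord_recr /=.
rewrite binn subnn expr0 mul1r mulr1n addrK horner_sum; apply: eq_bigr => i _.
by rewrite hornerMn hornerXn expr1n mul1r.
Qed.

Lemma is_differenceP (p : {poly rat}) : is_difference p.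
Proof.
rewrite -[p]coefK poly_def; apply: big_ind => [||i _].
- exact: is_difference0.
- exact: is_differenceD.
exact/is_differenceZ/is_differenceXn.
Qed.

Lemma eventually_poly_partial_sum (h : nat -> nat) :
  eventually_poly h -> eventually_poly (fun n => (\sum_(j < n.+1) h j)%N).
Proof.
move=> [p [N hp]]; have [q qP] := is_differenceP p.
(* The terms from [N] to n telescope to q(n+1) - q(N); the finitely many earlier terms only add a
   constant. *)
exists (q \Po ('X + 1) + ((\sum_(j < N) h j)%N%:R - q.[N%:R])%:P), N => n leNn.
rewrite !(hornerE, horner_comp) -(subnKC leNn).
elim: (n - N)%N => [|m IHm].
  rewrite addn0 big_ord_recr natrD hp //= -qP.
 by rewrite addrCA addrA.
rewrite addnS big_ord_recr natrD IHm hp -?addnS ?leq_addr //= -qP.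
by rewrite addnS -natr1 [LHS]addrC -!addrA addKr.
Qed.

End EventuallyPolynomial.

(** * Upward closed and tame sets of vectors, and counting by sum *)

Section Tame.

(** Hereditary stability of slices in the first coordinate, for lists of length [k]. Unlike upward
    closure, it survives complements. *)
Fixpoint tame (k : nat) (A : pred (seq nat)) : Prop :=
  if k is k'.+1 then
    (forall i, tame k' (fun s => A (i :: s))) /\
    exists i0, forall i s, i0 <= i -> size s = k' -> A (i :: s) = A (i0 :: s)
  else True.

Lemma tame_eq (k : nat) (A B : pred (seq nat)) :
  (forall s, size s = k -> A s = B s) -> tame k A -> tame k B.
Proof.
elim: k A B => //= k IHk A B eqAB [tA [i0 stA]]; split=> [i|].
  by apply: IHk (tA i) => s sz_s; rewrite eqAB //= sz_s.
by exists i0 => i s le_i0 sz_s; rewrite -!eqAB ?stA //= sz_s.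
Qed.

Lemma tame_true (k : nat) : tame k predT.
Proof. by elim: k => //= k IHk; split=> //; exists 0. Qed.

Lemma tame_negb (k : nat) (A : pred (seq nat)) :
  tame k A -> tame k (fun s => ~~ A s).
Proof.
elim: k A => //= k IHk A [tA [i0 stA]]; split=> [i|]; first exact: IHk.
by exists i0 => i s le_i0 sz_s; rewrite stA.
Qed.

Lemma tame_and (k : nat) (A B : pred (seq nat)) :
  tame k A -> tame k B -> tame k (fun s => A s && B s).
Proof.
elim: k A B => //= k IHk A B [tA [i0 stA]] [tB [j0 stB]]; split=> [i|].
  exact: IHk.
exists (maxn i0 j0) => i s; rewrite geq_max => /andP[le_i le_j] sz_s.
rewrite stA // stB // [in RHS]stA ?leq_maxl // [in RHS]stB //.
exact: leq_maxr.
Qed.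

Lemma tame_all (k : nat) (I : Type) (r : seq I) (A : I -> pred (seq nat)) :
  (forall i, tame k (A i)) -> tame k (fun s => all (A^~ s) r).
Proof.
by move=> tA; elim: r => [|i r IHr]; [apply: tame_true | apply: tame_and].
Qed.

(** Valued in [Prop] because the union of all slices, to which Dickson's lemma is applied, is an
    unbounded existential. *)
Definition upset (k : nat) (U : seq nat -> Prop) : Prop :=
  forall s t, size s = k -> all2 leq s t -> U s -> U t.

Lemma all2_leqnn (s : seq nat) : all2 leq s s.
Proof. by elim: s => //= i s ->; rewrite leqnn. Qed.

Lemma all2_leq_trans (s t u : seq nat) :
  all2 leq s t -> all2 leq t u -> all2 leq s u.
Proof.
elim: s t u => [|i s IHs] [|j t] [|l u] //=.
move=> /andP[le_ij le_st] /andP[le_jl le_tu].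
by rewrite (leq_trans le_ij) // (IHs t).
Qed.

Lemma upset_slice (k i : nat) (U : seq nat -> Prop) :
  upset k.+1 U -> upset k (fun s => U (i :: s)).
Proof.
move=> upU s t sz_s le_st; apply: upU => /=; first by rewrite sz_s.
by rewrite leqnn.
Qed.

Lemma upset_cons_mono (k i j : nat) (s : seq nat) (U : seq nat -> Prop) :
  upset k.+1 U -> size s = k -> i <= j -> U (i :: s) -> U (j :: s).
Proof.
move=> upU sz_s le_ij; apply: upU => /=; first by rewrite sz_s.
by rewrite le_ij all2_leqnn.
Qed.

Definition finitely_generated (k : nat) (U : seq nat -> Prop) : Prop :=
  exists G : seq (seq nat),
    (forall g, g \in G -> size g = k /\ U g) /\
    (forall s, size s = k -> U s -> exists2 g, g \in G & all2 leq g s).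

(* Finitely many generators of the union of the slices lie in one slice. *)
Lemma upset_slices_stable (k : nat) (U : seq nat -> Prop) :
  (forall V, upset k V -> finitely_generated k V) -> upset k.+1 U ->
  exists i0, forall i s, size s = k -> U (i :: s) -> U (i0 :: s).
Proof.
move=> fgk upU.
have [|G [GV genG]] := fgk (fun s => exists i, U (i :: s)).
  move=> s t sz_s le_st [i Ui]; exists i.
  exact: (upset_slice upU sz_s le_st Ui).
have [i0 Ui0] : exists i0, forall g, g \in G -> U (i0 :: g).
  elim: G GV {genG} => [|g G IHG] GV; first by exists 0.
  have [|i0 Ui0] := IHG; first by move=> h hG; apply: GV; rewrite inE hG orbT.
  have [sz_g [j Uj]] := GV g (mem_head _ _).
  exists (maxn i0 j) => h; rewrite inE => /predU1P[-> | hG].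
    exact: (upset_cons_mono upU sz_g (leq_maxr _ _)) Uj.
  have [|sz_h _] := GV h; first by rewrite inE hG orbT.
  exact: (upset_cons_mono upU sz_h (leq_maxl _ _)) (Ui0 h hG).
exists i0 => i s sz_s Uis.
have [|g gG le_gs] := genG s sz_s; first by exists i.
have [sz_g _] := GV g gG; exact: (upset_slice upU sz_g le_gs (Ui0 g gG)).
Qed.

(** Generators of the slices up to [i0], each prefixed by its index, suffice: a tail occurring in a
    later slice already lies in slice [i0]. *)
Lemma dickson (k : nat) (U : seq nat -> Prop) :
  upset k U -> finitely_generated k U.
Proof.
elim: k U => [|k IHk] U upU.
  (* Membership in [U] is not decidable, hence the excluded middle. *)
  have [U0 | nU0] := classic (U [::]).
    exists [:: [::]]; split=> [g|[|//]]; last by exists [::].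
    by rewrite inE => /eqP->.
  by exists [::]; split=> // -[|//] _ /nU0.
have [i0 stU] := upset_slices_stable IHk upU.
have [G [GU genG]] : exists G : seq (seq nat),
    (forall g, g \in G -> size g = k.+1 /\ U g) /\
    (forall i s, i < i0.+1 -> size s = k -> U (i :: s) ->
       exists2 g, g \in G & all2 leq g (i :: s)).
  elim: i0.+1 => [|m [G [GU genG]]]; first by exists [::].
  have [H [HU genH]] := IHk _ (upset_slice (i := m) upU).
  exists (map (cons m) H ++ G); split=> [g|i s].
    rewrite mem_cat => /orP[/mapP[h hH ->]|]; last exact: GU.
    by have [sz_h Uh] := HU h hH; rewrite /= sz_h.
  rewrite ltnS leq_eqVlt => /predU1P[-> | lt_im] sz_s Us.
    have [h hH le_hs] := genH s sz_s Us.
    by exists (m :: h); rewrite /= ?leqnn // mem_cat map_f.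
  have [g gG le_gs] := genG i s lt_im sz_s Us.
  by exists g => //; rewrite mem_cat gG orbT.
exists G; split=> // -[//|i s] [sz_s] Us.
have [le_i | lt_i] := leqP i i0; first exact: genG.
have [g gG le_gs] := genG i0 s (leqnn _) sz_s (stU i s sz_s Us).
exists g => //; apply: all2_leq_trans le_gs _.
by rewrite /= ltnW // all2_leqnn.
Qed.

(** Slices of an upward closed set increase with the first coordinate, so they are constant once one
    of them contains all the others. *)
Lemma upset_tame (k : nat) (A : pred (seq nat)) : upset k A -> tame k A.
Proof.
elim: k A => //= k IHk A upA; split=> [i|].
  by apply: IHk; exact: (upset_slice (U := A) upA).
have [i0 stA] := upset_slices_stable (@dickson k) upA.
exists i0 => i s le_i sz_s; apply/idP/idP; first exact: stA.
exact: (upset_cons_mono (U := A) upA sz_s le_i).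
Qed.

(** Weak compositions: parts may be zero, and the empty list composes only 0. *)
Fixpoint compositions (k n : nat) : seq (seq nat) :=
  if k is k'.+1 then
    flatten [seq map (cons i) (compositions k' (n - i)) | i <- iota 0 n.+1]
  else nseq (n == 0) [::].

Lemma compositionsS (k n : nat) :
  compositions k.+1 n =
  [seq i :: s | i <- iota 0 n.+1, s <- compositions k (n - i)].
Proof. by []. Qed.

Lemma mem_compositions (k n : nat) (s : seq nat) :
  (s \in compositions k n) = (size s == k) && (sumn s == n).
Proof.
elim: k n s => [|k IHk] n s.
  rewrite mem_nseq; case: s => [|i s]; last by rewrite andbF.
  by rewrite !eqxx andbT lt0b eq_sym.
rewrite compositionsS; apply/allpairsPdep/andP => [[i [t []]] | []].
  rewrite mem_iota ltnS => /= le_in; rewrite IHk.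
  move=> /andP[/eqP <- /eqP sum_t] ->.
  by rewrite /= sum_t subnKC.
case: s => [//|i s] /eqP[sz_s] /eqP sum_s.
exists i, s; split=> //.
  by rewrite mem_iota add0n ltnS -sum_s /= leq_addr.
by rewrite IHk sz_s -sum_s addKn !eqxx.
Qed.

Lemma uniq_compositions (k n : nat) : uniq (compositions k n).
Proof.
elim: k n => [|k IHk] n; first by case: n.
rewrite compositionsS.
apply: allpairs_uniq_dep => [|i _|]; [exact: iota_uniq | exact: IHk |].
by move=> [i s] [j t] _ _ /= [-> ->].
Qed.

Lemma tame_count (k : nat) (A : pred (seq nat)) :
  tame k A -> eventually_poly (fun n => count A (compositions k n)).
Proof.
elim: k A => [|k IHk] A.
  (* With no parts, only n = 0 has a composition, so the count vanishes from 1 on. *)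
  by exists 0%R, 1 => -[|n] // _; rewrite horner0.
case=> tA [i0 stA].
pose h i n := count (fun s => A (i :: s)) (compositions k n).
have hP i : eventually_poly (h i) by exact: (IHk _ (tA i)).
have := eventually_poly_add
  (eventually_poly_sum i0 (fun i => eventually_poly_shift i (hP i)))
  (eventually_poly_shift i0 (eventually_poly_partial_sum (hP i0))).
apply: (@eventually_poly_eq_from i0) => n le_i0n.
rewrite compositionsS count_flatten -map_comp sumnE big_map.
rewrite -/(index_iota 0 n.+1) (big_cat_nat (n := i0)) //=; last exact: leqW.
congr (_ + _).
  rewrite big_mkord; apply: eq_bigr => i _; exact/esym/count_map.
(* Reversing the sum over i from [i0] to n, the index becomes j = n - i, from 0 to n - [i0]; every
   slice met is then slice [i0], which leaves a partial sum of [h i0]. *)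
rewrite big_nat_rev /= -[X in \sum_(X <= _ < _) _]add0n big_addn subSn //.
rewrite big_mkord.
apply: eq_bigr => -[j /=]; rewrite ltnS => le_j _; rewrite count_map.
rewrite addnS subSS addnC subnDr.
have le_jn : j <= n := leq_trans le_j (leq_subr _ _).
rewrite subKn //; apply: eq_in_count => s.
rewrite mem_compositions => /andP[/eqP sz_s _] /=.
by rewrite [RHS]stA // leq_subRL // addnC -leq_subRL.
Qed.

End Tame.

(** * Words up to permutation as vectors of multiplicities *)

Section Words.
Variable K : eqType.
Implicit Types (e w u : seq K) (s t : seq nat).

(** Picks one word for each multiset over the alphabet [e]; [multiplicities] inverts it up to
    permutation. *)
Definition word_of e s : seq K := flatten [seq nseq p.2 p.1 | p <- zip e s].

Definition multiplicities e w : seq nat := [seq count_mem x w | x <- e].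

Lemma size_word_of e s : size s = size e -> size (word_of e s) = sumn s.
Proof.
by elim: e s => [|x e IHe] [|i s] //= [sz_s]; rewrite size_cat size_nseq IHe.
Qed.

Lemma word_of_subset e s : {subset word_of e s <= e}.
Proof.
elim: e s => [|x e IHe] [|i s] //= y; rewrite mem_cat inE.
by rewrite mem_nseq => /orP[/andP[_ ->] // | /IHe ->]; rewrite orbT.
Qed.

Lemma multiplicities_word_of e s :
  uniq e -> size s = size e -> multiplicities e (word_of e s) = s.
Proof.
rewrite /multiplicities.
elim: e s => [|x e IHe] [|i s] //= /andP[xNe uniq_e] [sz_s].
rewrite count_cat count_nseq /= eqxx mul1n (count_memPn _) ?addn0; last first.
  by apply: contra xNe; apply: word_of_subset.
congr (_ :: _); rewrite -[RHS]IHe //; apply/eq_in_map => y ye.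
rewrite count_cat count_nseq /=; case: eqP => [xy|//].
by rewrite xy ye in xNe.
Qed.

Lemma perm_word_of_multiplicities e w :
  uniq e -> {subset w <= e} -> perm_eq (word_of e (multiplicities e w)) w.
Proof.
move=> uniq_e we; apply/allP => x _ /=; apply/eqP.
have [xe | xNe] := boolP (x \in e); last first.
  rewrite (count_memPn _) ?(count_memPn _) //; first exact: contra (we x) _.
  by apply: contra xNe; apply: word_of_subset.
have : multiplicities e (word_of e (multiplicities e w)) = multiplicities e w.
  by rewrite multiplicities_word_of ?size_map.
by move/eq_in_map/(_ x xe).
Qed.

Lemma perm_multiplicities e w w' :
  uniq e -> {subset w <= e} -> {subset w' <= e} ->
  (multiplicities e w == multiplicities e w') = perm_eq w w'.
Proof.
move=> uniq_e we w'e; apply/eqP/idP => [eq_m | /seq.permP eq_c]; last first.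
  by apply: eq_map => x.
rewrite -(permPl (perm_word_of_multiplicities uniq_e we)) eq_m.
exact: perm_word_of_multiplicities.
Qed.

Lemma word_of_mono e s t :
  size s = size e -> all2 leq s t ->
  exists u, perm_eq (word_of e t) (word_of e s ++ u).
Proof.
elim: e s t => [|x e IHe] [|i s] [|j t] //=; first by exists [::].
case=> sz_s /andP[le_ij le_st]; have [u eq_tsu] := IHe s t sz_s le_st.
exists (nseq (j - i) x ++ u); rewrite /word_of /= -!/(word_of _ _).
rewrite -{1}(subnKC le_ij) nseqD -!catA perm_cat2l.
by rewrite perm_sym perm_catCA perm_cat2l perm_sym.
Qed.

(** Adding letters and permuting in one condition; empty [u] gives permutation invariance. *)
Definition upward (P : pred (seq K)) : Prop :=
  forall w u w', perm_eq w' (w ++ u) -> P w -> P w'.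

Lemma upward_perm (P : pred (seq K)) w w' :
  upward P -> perm_eq w w' -> P w = P w'.
Proof.
move=> upP eq_ww'; apply/idP/idP; apply: (upP _ [::]).
  by rewrite cats0 perm_sym.
by rewrite cats0.
Qed.

Lemma upward_tame (P : pred (seq K)) e :
  upward P -> tame (size e) (fun s => P (word_of e s)).
Proof.
move=> upP; apply: upset_tame => s t sz_s le_st.
by have [u] := word_of_mono sz_s le_st; apply: upP.
Qed.

Lemma upward_mem (x : K) : upward (fun w => x \in w).
Proof. by move=> w u w' /perm_mem-> xw; rewrite mem_cat xw. Qed.

(** If [x] already occurs in [w], removing it commutes, up to permutation, with adding letters. The
    conjunct [x \in w] matters: otherwise an added [x] could itself be the letter removed. *)
Lemma upward_replace (P : pred (seq K)) (x y : K) :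
  upward P -> upward (fun w => (x \in w) && P (y :: rem x w)).
Proof.
move=> upP w u w' eq_w' /andP[xw Pw].
rewrite (upward_mem eq_w' xw); apply: (upP _ u) Pw => /=.
rewrite perm_cons; have xw' := upward_mem eq_w' xw.
rewrite -(perm_cons x) -(permPl (perm_to_rem xw')) (permPl eq_w').
by rewrite -[x :: _]/((x :: rem x w) ++ u) perm_cat2r perm_to_rem.
Qed.

End Words.

(** Only coincidences among values affect the count, so orbits can be counted through any complete
    invariant. *)
Lemma size_undup_map (T : Type) (U V : eqType) (f : T -> U) (g : T -> V)
    (r : seq T) :
  (forall x y, (f x == f y) = (g x == g y)) ->
  size (undup (map f r)) = size (undup (map g r)).
Proof.
move=> eq_fg; elim: r => //= x r IHr.
have -> : (f x \in map f r) = (g x \in map g r).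
  by elim: r {IHr} => //= y r IHr; rewrite !inE eq_fg IHr.
by case: ifP => //= _; rewrite IHr.
Qed.

Lemma card_imset_undup (T U : finType) (f : T -> U) (A : {set T}) :
  #|f @: A| = size (undup (map f (enum A))).
Proof.
rewrite -(card_uniqP (undup_uniq _)); apply: eq_card => y.
rewrite mem_undup; apply/imsetP/mapP => -[x xA ->]; exists x => //.
  by rewrite mem_enum.
by rewrite mem_enum in xA.
Qed.

(** * Subsets of [n]^c as words of columns, and their orbits *)

Section Columns.
Variable c : nat.
Local Notation K := {set 'I_c}.

Definition column (n : nat) (F : {set vert c n}) (j : 'I_n) : K :=
  [set i | (i, j) \in F].

Definition columns (n : nat) (F : {set vert c n}) : n.-tuple K :=
  [tuple column F j | j < n].

Definition of_columns (n : nat) (w : seq K) : {set vert c n} :=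
  [set v : vert c n | v.1 \in nth set0 w v.2].

Lemma columnsK (n : nat) (F : {set vert c n}) : of_columns n (columns F) = F.
Proof.
apply/setP => -[i j]; rewrite inE /= (nth_map j) ?size_enum_ord //.
by rewrite nth_ord_enum inE.
Qed.

Lemma of_columnsK (n : nat) (w : seq K) :
  size w = n -> columns (of_columns n w) = w :> seq K.
Proof.
move=> sz_w; apply: (@eq_from_nth _ set0); rewrite size_tuple // => j lt_jn.
rewrite -[j]/(val (Ordinal lt_jn)) -tnth_nth tnth_mktuple.
by apply/setP => i; rewrite !inE.
Qed.

(** Permuting [n] moves whole columns around, and every rearrangement of columns arises this way. *)
Lemma perm_columns (n : nat) (F G : {set vert c n}) :
  reflect (exists s : 'S_n, setact (sym_action c n) F s = G)
          (perm_eq (columns F) (columns G)).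
Proof.
have colE (s : 'S_n) (H : {set vert c n}) j :
    column (setact (sym_action c n) H s) (s j) = column H j.
  apply/setP => i; rewrite !inE.
  have -> : (i, s j) = sym_action c n (i, j) s by [].
  exact: (mem_imset _ _ (act_inj (sym_action c n) s)).
apply: (iffP idP) => [|[s <-]]; last first.
  apply/tuple_permP; exists s; congr val; apply: eq_from_tnth => j.
  by rewrite !tnth_mktuple colE.
(* Here column j of [G] is column [s j] of [F], whereas the action sends column j to place [s j];
   hence the inverse. *)
rewrite perm_sym => /tuple_permP[s eq_GF]; exists s^-1%g.
have eq_col j : column G j = column F (s j).
  have /(congr1 (fun t => tnth t j)) := val_inj eq_GF.
  by rewrite !tnth_mktuple.
rewrite -[LHS]columnsK -[RHS]columnsK; congr (of_columns _ (val _)).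
apply: eq_from_tnth => j; rewrite !tnth_mktuple eq_col.
by rewrite -[in LHS](permK s j) colE.
Qed.

Lemma orbit_eq_columns (n : nat) (F G : {set vert c n}) :
  (orbit (sym_action c n)^* [set: 'S_n] F
     == orbit (sym_action c n)^* [set: 'S_n] G)%act
  = perm_eq (columns F) (columns G).
Proof.
rewrite eq_sym orbit_eq_mem.
by apply/orbitP/perm_columns => [[s _ <-]|[s <-]]; exists s.
Qed.

Lemma perm_columnsC (n : nat) (F G : {set vert c n}) :
  perm_eq (columns (~: F)) (columns (~: G)) = perm_eq (columns F) (columns G).
Proof.
have colC (H : {set vert c n}) :
    columns (~: H) = map (@setC _) (columns H) :> seq K.
  rewrite /= -map_comp; apply: eq_map => j.
  by apply/setP => i; rewrite !inE.
rewrite !colC; apply/idP/idP => [|/perm_map//].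
by move/perm_map_inj; apply; apply: (can_inj (@setCK _)).
Qed.

End Columns.

(** Assumes tameness of the conjunction rather than of [B], since replacing a column is upward
    closed only together with the presence of that column. *)
Lemma tame_imply (k : nat) (A B : pred (seq nat)) :
  tame k A -> tame k (fun s => A s && B s) -> tame k (fun s => A s ==> B s).
Proof.
move=> tA tAB; have := tame_negb (tame_and tA (tame_negb tAB)).
by apply: tame_eq => s _; case: (A s); case: (B s).
Qed.

Lemma mem_alexander_dual (T : finType) (D : {set {set T}}) (F : {set T}) :
  (F \in alexander_dual D) = (~: F \notin D).
Proof.
apply/imsetP/idP => [[G GND ->] | FND]; first by rewrite setCK -in_setC.
by exists (~: F); rewrite ?setCK // in_setC.
Qed.

(** Deleting single points suffices to test minimality: a proper subset of [F] lies in some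
    [F :\ v], and [D] is closed under subsets. *)
Lemma facets_dualP (T : finType) (D : {set {set T}}) (F : {set T}) :
  simplicial_complex D ->
  reflect (F \notin D /\ forall v, v \in F -> F :\ v \in D)
          (~: F \in facets (alexander_dual D)).
Proof.
move=> cplxD; rewrite inE.
apply: (iffP maxsetP); rewrite /= mem_alexander_dual setCK => -[FND minF].
  split=> // v vF; apply/negPn/negP => FvND.
  have : ~: (F :\ v) = ~: F.
    by apply: minF; rewrite /= ?mem_alexander_dual ?setCK // setCS subD1set.
  by move/setC_inj => eqF; rewrite -eqF setD11 in vF.
split=> // B; rewrite /= mem_alexander_dual => BND sFB.
apply/eqP; rewrite eqEsubset sFB andbT -setCS setCK.
apply/subsetP => v vF; apply: contraNT BND => vNB.
apply: cplxD (minF v vF) _; apply/subsetP => u uNB; rewrite in_setD1.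
rewrite (contraNneq _ vNB) => [|<- //].
rewrite in_setC in uNB; apply: contraR uNB => uNF.
by apply: (subsetP sFB); rewrite inE.
Qed.

(** * Faces and minimal nonfaces of a chain, in terms of words *)

Section Chain.
Variables (c : nat) (Delta : forall n : nat, {set {set vert c n}}).
Hypothesis chainD : sym_invariant_chain Delta.
Local Notation K := {set 'I_c}.

(** Gathers all the complexes into one predicate on words; the empty word is excluded because
    [Delta 0] is unconstrained. *)
Definition is_face (w : seq K) : bool :=
  (0 < size w) && (of_columns (size w) w \in Delta (size w)).

Lemma is_face_size (n : nat) (w : seq K) :
  size w = n -> is_face w = (0 < n) && (of_columns n w \in Delta n).
Proof. by move=> <-. Qed.

Lemma is_face_columns (n : nat) (F : {set vert c n}) :
  0 < n -> is_face (columns F) = (F \in Delta n).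
Proof.
by move=> n_gt0; rewrite (is_face_size (size_tuple _)) n_gt0 columnsK.
Qed.

Lemma of_columns_rcons (n : nat) (w : seq K) (x : K) :
  size w = n ->
  of_columns n.+1 (rcons w x) =
  (widen_vert (leqnSn n) @: of_columns n w)
    :|: [set v : vert c n.+1 | (v.2 == n :> nat) && (v.1 \in x)].
Proof.
move=> sz_w; apply/setP => -[i j]; rewrite !inE /= nth_rcons sz_w.
have [lt_jn | le_nj] := ltnP j n.
  rewrite (ltn_eqF lt_jn) orbF.
  have -> : (i, j) = widen_vert (leqnSn n) (i, Ordinal lt_jn).
    by congr pair; apply: val_inj.
  rewrite mem_imset ?inE //.
  by move=> [a b] [a' b'] [-> eq_b]; congr pair; apply: val_inj.
have -> : j = n :> nat by apply/eqP; rewrite eqn_leq le_nj -ltnS ltn_ord.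
rewrite eqxx /=; case: imsetP => [[[a b] _ [_ /(congr1 val) /= eq_b]]|//].
by move: le_nj; rewrite eq_b leqNgt ltn_ord.
Qed.

(** The cone condition: the appended column is an arbitrary set of new vertices. *)
Lemma is_face_rcons (w : seq K) (x : K) : is_face w -> is_face (rcons w x).
Proof.
have [_ _ coneD] := chainD.
move=> /andP[w_gt0 wD]; rewrite (is_face_size (size_rcons _ _)) /=.
rewrite of_columns_rcons //; apply: (subsetP (coneD _ w_gt0)).
apply: imset2_f => //; rewrite inE; apply/subsetP => v.
rewrite !inE => /andP[/eqP v_n _].
apply/imsetP => -[[a b] _ eq_v]; move: v_n; rewrite eq_v /= => b_n.
by have := ltn_ord b; rewrite b_n ltnn.
Qed.

Lemma is_face_perm (w w' : seq K) : perm_eq w w' -> is_face w -> is_face w'.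
Proof.
have [_ symD _] := chainD.
move=> eq_w /andP[w_gt0 wD].
have sz_w' : size w' = size w by rewrite (perm_size eq_w).
rewrite (is_face_size sz_w') w_gt0 /=.
have : perm_eq (columns (of_columns (size w) w))
               (columns (of_columns (size w) w')).
  by rewrite !of_columnsK.
case/perm_columns => s <-; have := symD _ _ (leqnn _) s _ w_gt0 wD.
(* Invariance is used with m = n, where [widen_vert] is the identity. *)
rewrite (eq_imset (g := id)) ?imset_id // => -[i j].
by congr pair; apply: val_inj.
Qed.

Lemma upward_is_face : upward is_face.
Proof.
move=> w u w' eq_w' wD; rewrite perm_sym in eq_w'; apply: is_face_perm eq_w' _.
elim/last_ind: u => [|u x IHu]; first by rewrite cats0.
by rewrite -rcons_cat is_face_rcons.
Qed.

(** Deleting a vertex replaces one occurrence of a column S by S minus a point. The pairs range over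
    a list independent of [w], so this is a fixed finite Boolean combination of conditions on
    [w]. *)
Definition is_minimal_nonface (w : seq K) : bool :=
  ~~ is_face w &&
  all (fun p : K * 'I_c => (p.1 \in w) ==> is_face ((p.1 :\ p.2) :: rem p.1 w))
      [seq p : K * 'I_c <- enum {: K * 'I_c} | p.2 \in p.1].

Lemma is_minimal_nonface_perm (w w' : seq K) :
  perm_eq w w' -> is_minimal_nonface w = is_minimal_nonface w'.
Proof.
move=> eq_w; rewrite /is_minimal_nonface (upward_perm upward_is_face eq_w).
congr (_ && _); apply: eq_all => p; rewrite (perm_mem eq_w).
case: (boolP (p.1 \in w')) => //= pw'; apply: (upward_perm upward_is_face).
rewrite perm_cons -(perm_cons p.1) -(permPl (perm_to_rem _)).
  by rewrite (permPl eq_w) perm_to_rem.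
by rewrite (perm_mem eq_w).
Qed.

Lemma tame_is_minimal_nonface (e : seq K) :
  tame (size e) (fun s => is_minimal_nonface (word_of e s)).
Proof.
apply: tame_and; first exact/tame_negb/(upward_tame e upward_is_face).
apply: (@tame_all _ _ _ (fun (p : K * 'I_c) s => (p.1 \in word_of e s) ==>
          is_face ((p.1 :\ p.2) :: rem p.1 (word_of e s)))) => p.
apply: tame_imply; first exact: (upward_tame e (upward_mem (x := p.1))).
exact: (upward_tame e (upward_replace (x := p.1) (y := p.1 :\ p.2)
                         upward_is_face)).
Qed.

Lemma columns_setD1 (n : nat) (F : {set vert c n}) (i : 'I_c) (j : 'I_n) :
  perm_eq (columns (F :\ (i, j)))
          ((column F j :\ i) :: rem (column F j) (columns F)).
Proof.
have perm_e : perm_eq (enum 'I_n) (j :: rem j (enum 'I_n)).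
  by rewrite perm_to_rem // mem_enum.
have -> : column F j :\ i = column (F :\ (i, j)) j.
  by apply/setP => i'; rewrite !inE xpair_eqE eqxx andbT.
rewrite /= (permPl (perm_map _ perm_e)) /= perm_cons.
rewrite -(perm_cons (column F j)) -(permPr (perm_to_rem _)); last first.
  by apply: map_f; rewrite mem_enum.
rewrite (permPr (perm_map _ perm_e)) /= perm_cons.
suff -> : map (column (F :\ (i, j))) (rem j (enum 'I_n))
        = map (column F) (rem j (enum 'I_n)) by [].
apply/eq_in_map => j'; rewrite mem_rem_uniq ?enum_uniq // inE => /andP[j'j _].
by apply/setP => i'; rewrite !inE xpair_eqE (negPf j'j) andbF.
Qed.

Lemma is_minimal_nonface_columns (n : nat) (F : {set vert c n}) :
  0 < n ->
  is_minimal_nonface (columns F) = (~: F \in facets (alexander_dual (Delta n))).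
Proof.
move=> n_gt0; have [cplxD _ _] := chainD.
rewrite /is_minimal_nonface is_face_columns //.
have faceD1 i j : is_face ((column F j :\ i) :: rem (column F j) (columns F))
    = (F :\ (i, j) \in Delta n).
  rewrite -(upward_perm upward_is_face (columns_setD1 F i j)).
  exact: is_face_columns.
apply/andP/(facets_dualP _ (cplxD n n_gt0)) => -[FND minF]; split=> //.
  move=> [i j] ijF; rewrite -faceD1.
  have /= := allP minF (column F j, i); rewrite mem_filter /= inE ijF mem_enum.
  by move/(_ isT)/implyP; apply; apply: map_f; rewrite mem_enum.
apply/allP => -[S i]; rewrite mem_filter /= => /andP[iS _].
(* S may occur at several places; any [j] will do, as [is_face] ignores order. *)
apply/implyP => /mapP[j _ defS]; rewrite {}defS in iS *.
by rewrite faceD1 minF //; rewrite inE in iS.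
Qed.

(** The multiplicity vector of the columns of the complement is a complete orbit invariant; its
    values on facets are exactly the counted vectors. *)
Lemma num_facet_orbits_dual (n : nat) :
  0 < n ->
  num_facet_orbits (alexander_dual (Delta n)) =
  count (fun s => is_minimal_nonface (word_of (enum K) s))
        (compositions (size (enum K)) n).
Proof.
move=> n_gt0.
have subK (w : seq K) : {subset w <= enum K} by move=> x _; rewrite mem_enum.
have uniqK : uniq (enum K) := enum_uniq K.
have permK (w : seq K) :
    perm_eq (word_of (enum K) (multiplicities (enum K) w)) w.
  exact: perm_word_of_multiplicities.
rewrite /num_facet_orbits card_imset_undup.
rewrite (size_undup_map
           (g := fun F => multiplicities (enum K) (columns (~: F)))).
  rewrite -size_filter; apply: perm_size; apply: uniq_perm.
  - exact: undup_uniq.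
  - exact/filter_uniq/uniq_compositions.
  move=> s; rewrite mem_undup mem_filter mem_compositions.
  apply/mapP/and3P => [[F] | [min_s /eqP sz_s /eqP sum_s]].
    rewrite mem_enum -{1}[F]setCK => facetF ->; split.
    - rewrite (is_minimal_nonface_perm (permK _)).
      by rewrite is_minimal_nonface_columns.
    - by rewrite size_map.
    rewrite -(size_word_of (e := enum K)) ?size_map //.
    by rewrite (perm_size (permK _)); apply/eqP/size_tuple.
  have col_s : columns (of_columns n (word_of (enum K) s))
             = word_of (enum K) s :> seq K.
    by rewrite of_columnsK // size_word_of.
  exists (~: of_columns n (word_of (enum K) s)).
    by rewrite mem_enum -is_minimal_nonface_columns // col_s.
  by rewrite setCK col_s multiplicities_word_of.
move=> F G; rewrite orbit_eq_columns.
by rewrite (perm_multiplicities uniqK (subK _) (subK _)) perm_columnsC.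
Qed.

End Chain.

Theorem theorem1p1 (c : nat) (c_gt0 : 0 < c)
    (Delta : forall n : nat, {set {set vert c n}}) :
  sym_invariant_chain Delta ->
  exists p : {poly rat}, exists N : nat, forall n : nat, N <= n ->
    ((num_facet_orbits (alexander_dual (Delta n)))%:R = p.[n%:R] :> rat)%R.
Proof.
move=> chainD.
have := tame_count (tame_is_minimal_nonface chainD (enum {set 'I_c})).
(* The count is matched from n = 1 on, as nothing is assumed about [Delta 0]. *)
apply: (@eventually_poly_eq_from 1) => n n_gt0.
by rewrite num_facet_orbits_dual.
Qed.
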